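(* Let $\mathcal{P}$ be an $n\times n$ symmetric sign pattern with all diagonal entries equal to $0$ whose underlying graph $G(\mathcal{P})$ is a cycle of length $n$ ($n\ge 3$). Then $\mathcal{P}$ requires full $P$-vertices if and only if $n$ is even and all composite cycles of length $n$ in the signed directed graph $D(\mathcal{P})$ have the same sign.
   Context: A sign pattern of order $n$ is an $n\times n$ matrix $\mathcal{P}=[p_{ij}]$ with entries in $\{+,-,0\}$; it is symmetric if $p_{ij}=p_{ji}$ for all $i,j$. $\mathcal{Q}_{\mathrm{SYM}}(\mathcal{P})$ is the set of all real symmetric $n\times n$ matrices $A=[a_{ij}]$ with $\mathrm{sgn}(a_{ij})=p_{ij}$ for all $i,j$. The underlying graph $G(\mathcal{P})$ is the undirected graph on vertices $v_1,\dots,v_n$ with an edge $\{v_i,v_j\}$ exactly when $p_{ij}\neq 0$. The signed directed graph $D(\mathcal{P})$ has vertices $v_1,\dots,v_n$ and a directed edge $(v_i,v_j)$, labelled by the sign $p_{ij}$, exactly when $p_{ij}\ne0$. A simple cycle of length $k\ge 1$ in $D(\mathcal{P})$ is a product $\gamma=p_{i_1i_2}p_{i_2i_3}\cdots p_{i_ki_1}$ of nonzero entries with $i_1,\dots,i_k$ distinct (so an edge $\{v_i,v_j\}$ of $G(\mathcal{P})$ gives a simple cycle $p_{ij}p_{ji}$ of length 2); its sign is $\mathrm{sgn}(\gamma)=(-1)^{k-1}p_{i_1i_2}p_{i_2i_3}\cdots p_{i_ki_1}$. A composite cycle is a product $\Gamma=\gamma_1\cdots\gamma_t$ ($t\ge1$)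 of mutually vertex-disjoint simple cycles; its length is the sum of the lengths of the $\gamma_i$ and its sign is $\prod_{i=1}^t\mathrm{sgn}(\gamma_i)$. For a real symmetric matrix $A$, $m_A(0)$ is the algebraic multiplicity of $0$ as an eigenvalue of $A$ (zero if $0$ is not an eigenvalue), and $A(j)$ is the principal submatrix obtained by deleting row and column $j$. The vertex $v_j$ is a $P$-vertex of $A$ if $m_{A(j)}(0)-m_A(0)=1$. The pattern $\mathcal{P}$ of order $n$ requires full $P$-vertices if, for every $A\in\mathcal{Q}_{\mathrm{SYM}}(\mathcal{P})$, all $n$ vertices are $P$-vertices of $A$. *)

(* Defs.v *)
From HB Require Import structures.
From mathcomp Require Import all_boot all_order all_algebra.
From mathcomp Require Import reals.

Set Implicit Arguments.
Unset Strict Implicit.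
Unset Printing Implicit Defensive.

Import Order.TTheory GRing.Theory Num.Theory.
Local Open Scope ring_scope.

(* The signs +, -, 0 are the integers 1, -1, 0. *)
Definition sign_pattern (n : nat) (P : 'M[int]_n) : Prop :=
  forall i j, P i j \in [:: 1; -1; 0].

Definition symmetric_pattern (n : nat) (P : 'M[int]_n) : Prop :=
  forall i j, P i j = P j i.

Definition Q_SYM (R : realType) (n : nat) (P : 'M[int]_n) (A : 'M[R]_n) : Prop :=
  A^T = A /\ forall i j, sgz (A i j) = P i j.

(* For a symmetric P this is the adjacency relation of the underlying graph
   G(P); for any P it is the arc relation of the signed digraph D(P). *)
Definition pattern_arc (n : nat) (P : 'M[int]_n) : rel 'I_n := fun i j => P i j != 0.

(* e is isomorphic to the cycle 0 - 1 - ... - (k-1) - 0; ordS is the cyclic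
   successor on 'I_k.  Meaningful for k >= 3. *)
Definition is_cycle_graph (T : finType) (e : rel T) (k : nat) : Prop :=
  exists2 f : 'I_k -> T, bijective f &
    forall i j, e (f i) (f j) = (j == ordS i) || (i == ordS j).

(* The cycle p_{i_1 i_2} p_{i_2 i_3} ... p_{i_k i_1} is encoded by its vertex
   sequence [:: i_1; ...; i_k].  The rotations of a sequence encode the same
   cycle; they all have the same length and sign. *)
Definition simple_cycle (n : nat) (P : 'M[int]_n) (s : seq 'I_n) : bool :=
  [&& (0 < size s)%N, uniq s & cycle (pattern_arc P) s].

Definition simple_sign (n : nat) (P : 'M[int]_n) (s : seq 'I_n) : int :=
  (-1) ^+ (size s).-1 * \prod_(i <- s) P i (next s i).

Definition composite_cycle (n : nat) (P : 'M[int]_n) (G : seq (seq 'I_n)) : bool :=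
  [&& (0 < size G)%N, all (simple_cycle P) G &
      pairwise (fun s t : seq 'I_n => [disjoint s & t]) G].

Definition composite_length (n : nat) (G : seq (seq 'I_n)) : nat :=
  (\sum_(s <- G) size s)%N.

Definition composite_sign (n : nat) (P : 'M[int]_n) (G : seq (seq 'I_n)) : int :=
  \prod_(s <- G) simple_sign P s.

Definition alg_mult0 (R : realType) (n : nat) (A : 'M[R]_n) : nat :=
  mup 0 (char_poly A).

Definition P_vertex (R : realType) (n : nat) (A : 'M[R]_n) (j : 'I_n) : Prop :=
  (alg_mult0 (row' j (col' j A)))%:Z - (alg_mult0 A)%:Z = 1.

Definition requires_full_P_vertices (R : realType) (n : nat) (P : 'M[int]_n) : Prop :=
  forall A : 'M[R]_n, Q_SYM P A -> forall j : 'I_n, P_vertex A j.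

(* Main.v *)
(* Number the vertices v_0, v_1, ... round the cycle and let a_k be the entry of
   A at (v_k, v_(k+1)); row v_(k+1) of A x is a_k x_k + a_(k+1) x_(k+2).
   Deleting a vertex leaves a path on n - 1 vertices.  Following this recurrence,
   a path on evenly many vertices is nonsingular, while a path on oddly many
   vertices is singular (it is bipartite) and 0 is a simple eigenvalue, since
   deleting one more end vertex leaves a nonsingular path.  So every vertex is a
   P-vertex exactly when n is even and A is nonsingular.  For n even, going once
   round the cycle multiplies a coordinate of a kernel vector by
   (-1)^(n/2) times a ratio whose sign is that of the product of all a_k: if the
   total is negative then A is nonsingular, and otherwise the (+-1)-matrix of the
   pattern is singular.  Finally the composite cycles of length n are the two
   perfect matchings, of sign (-1)^(n/2), and the full cycle, of sign minus the
   product of all p_k. *)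
Require Import Defs.
From mathcomp Require Import all_boot all_order all_algebra.
From mathcomp Require Import reals.
From mathcomp Require Import zify ring.

Import Order.TTheory GRing.Theory Num.Theory.
Local Open Scope ring_scope.

Set Implicit Arguments.
Unset Strict Implicit.
Unset Printing Implicit Defensive.

(** * Multiplicity of the eigenvalue 0 *)

Lemma alg_mult0_eq0 (R : realType) (n : nat) (A : 'M[R]_n) :
  (alg_mult0 A == 0)%N = (\det A != 0).
Proof.
have q0 : char_poly A != 0 by exact: monic_neq0 (char_poly_monic A).
rewrite /alg_mult0 -leqn0 leqNgt -XsubC_dvd // dvdp_XsubCl /root horner_coef0.
by rewrite char_poly_det mulf_eq0 signr_eq0.
Qed.

(** A diagonal entry of [U^T *m U] is the sum of the squares of a column of [U]. *)
Lemma mulmx_tr_eq0 (F : realDomainType) (m n : nat) (U : 'M[F]_(m, n)) :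
  U^T *m U = 0 -> U = 0.
Proof.
move=> UU; apply/matrixP => i j; rewrite mxE.
move/matrixP/(_ j j): UU; rewrite !mxE => /eqP.
rewrite psumr_eq0 => [|k _]; last by rewrite mxE -expr2 sqr_ge0.
by move/allP/(_ i (mem_index_enum i)); rewrite mxE mulf_eq0 orbb => /eqP.
Qed.

(* With M = adj(X - A) = U0 + U1 X + ... and X^2 dividing the characteristic
   polynomial, the two lowest coefficients of (X - A) M give A U0 = 0 and
   U0 = A U1, so U0^T U0 = (A U0)^T U1 = 0 and adj A = 0. *)
Lemma alg_mult0_eq1 (R : realType) (n : nat) (A : 'M[R]_n) (i j : 'I_n) :
  A^T = A -> \det A = 0 -> cofactor A i j != 0 -> alg_mult0 A = 1%N.
Proof.
move=> symA detA cof.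
have q0 : char_poly A != 0 by exact: monic_neq0 (char_poly_monic A).
apply/eqP; rewrite eqn_leq andbC lt0n alg_mult0_eq0 detA eqxx /=.
rewrite /alg_mult0 mup_leq // subr0; apply: contra cof => /dvdpP[r qE].
have [M ME] : {M | M = \adj (char_poly_mx A)} by exists (\adj (char_poly_mx A)).
pose U k : 'M[R]_n := \matrix_(a, b) (M a b)`_k.
have key a b : 'X * M a b - \sum_k (A a k)%:P * M k b = r * 'X^2 *+ (a == b).
  rewrite -qE; have /matrixP/(_ a b) := mul_mx_adj (char_poly_mx A).
  rewrite -ME.
  rewrite mulmxBl mul_scalar_mx !mxE => <-; congr (_ - _).
  by apply: eq_bigr => k _; congr (_ * _); rewrite mxE.
have AU0 : A *m U 0%N = 0.
  apply/matrixP => a b; have /(congr1 (fun p : {poly R} => p`_0)) := key a b.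
  rewrite coefB coefXM coefMn coefMXn /= mul0rn sub0r => /eqP.
  rewrite oppr_eq0 coef_sum => /eqP sum0; rewrite !mxE -[RHS]sum0.
  by apply: eq_bigr => k _; rewrite coefCM mxE.
have U0E : U 0%N = A *m U 1%N.
  apply/matrixP => a b; have /(congr1 (fun p : {poly R} => p`_1)) := key a b.
  rewrite coefB coefXM coefMn coefMXn /= mul0rn => /eqP.
  rewrite subr_eq0 coef_sum !mxE => /eqP->.
  by apply: eq_bigr => k _; rewrite coefCM mxE.
have U0 : U 0%N = 0.
  by apply: mulmx_tr_eq0; rewrite {2}U0E mulmxA -{1}symA -trmx_mul AU0 trmx0 mul0mx.
have U0_adj : U 0%N = \adj (-1 *: A).
  have -> : -1 *: A = map_mx (horner_eval 0) (char_poly_mx A).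
    apply/matrixP => a b; rewrite !mxE /horner_eval !hornerE hornerMn hornerX.
    by rewrite mul0rn sub0r mulN1r.
  by rewrite -map_mx_adj -ME;
  apply/matrixP => a b; rewrite !mxE -horner_coef0.
move/matrixP/(_ j i): U0; rewrite U0_adj !mxE cofactorZ => /eqP.
by rewrite mulf_eq0 signr_eq0.
Qed.

(* Conjugation by the diagonal matrix of colour signs turns A into -A. *)
Lemma det_bipartite_odd (F : numFieldType) (n : nat) (A : 'M[F]_n)
    (c : 'I_n -> bool) :
  odd n -> (forall i j, c i = c j -> A i j = 0) -> \det A = 0.
Proof.
move=> n_odd Ac; pose D : 'M[F]_n := diag_mx (\row_i (-1) ^+ c i).
have DAD : D *m A *m D = -1 *: A.
  rewrite mul_diag_mx mul_mx_diag; apply/matrixP => i j; rewrite !mxE.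
  case: (boolP (c i == c j)) => [/eqP/Ac -> | ]; first by rewrite mulr0 mul0r mulr0.
  by case: (c i) (c j) => [] [] //= _; rewrite !expr0 expr1 ?mulN1r ?mul1r ?mulrN1 ?mulr1.
have DD : \det D * \det D = 1.
  rewrite det_diag -big_split big1 //= => i _.
  by rewrite mxE -expr2 sqrr_sign.
move/(congr1 determinant): DAD.
rewrite !det_mulmx mulrAC DD mul1r detZ -signr_odd n_odd expr1 mulN1r => /eqP.
by rewrite -addr_eq0 -mulr2n mulrn_eq0 /= => /eqP.
Qed.

(** * Kernel vectors of principal submatrices *)

(** Inserting a zero at [j] carries a kernel vector of the submatrix to all vertices, where the
    recurrence along the cycle applies. *)
Definition extend0 (F : pzRingType) (n : nat) (j : 'I_n) (x : 'rV[F]_n.-1) : 'rV[F]_n :=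
  \row_i if unlift j i is Some k then x 0 k else 0.

Lemma extend0_at (F : pzRingType) (n : nat) (j : 'I_n) (x : 'rV[F]_n.-1) :
  extend0 j x 0 j = 0.
Proof. by rewrite mxE unlift_none. Qed.

Lemma extend0_lift (F : pzRingType) (n : nat) (j : 'I_n) (x : 'rV[F]_n.-1) k :
  extend0 j x 0 (lift j k) = x 0 k.
Proof. by rewrite mxE liftK. Qed.

Lemma mul_extend0 (F : pzRingType) (n : nat) (A : 'M[F]_n) (j : 'I_n)
    (x : 'rV[F]_n.-1) (k : 'I_n.-1) :
  (extend0 j x *m A) 0 (lift j k) = (x *m row' j (col' j A)) 0 k.
Proof.
rewrite !mxE (bigD1_ord j) //= extend0_at mul0r add0r.
by apply: eq_bigr => i _; rewrite extend0_lift !mxE.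
Qed.

Lemma extend0_ker (F : pzRingType) (n : nat) (A : 'M[F]_n) (j i : 'I_n)
    (x : 'rV[F]_n.-1) :
  x *m row' j (col' j A) = 0 -> i != j -> (extend0 j x *m A) 0 i = 0.
Proof.
move=> xA; case: (unliftP j i) => [k -> _|->]; last by rewrite eqxx.
by rewrite mul_extend0 xA mxE.
Qed.

Lemma extend0_eq0 (F : pzRingType) (n : nat) (j : 'I_n) (x : 'rV[F]_n.-1) :
  extend0 j x = 0 -> x = 0.
Proof. by move=> x0; apply/rowP => k; rewrite -(extend0_lift j) x0 !mxE. Qed.

(** * Walks round a cycle graph *)

(** Indices range over [nat], so the walk goes round endlessly: successors need no wrap-around, and
    [v n] is [v 0] again. *)
Record cyclic_walk (n : nat) (e : rel 'I_n) (v : nat -> 'I_n) : Prop := CyclicWalk {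
  walk_eq : forall i j, (v i == v j) = (i == j %[mod n])%N;
  walk_arc : forall i j, e (v i) (v j) = (v j == v i.+1) || (v i == v j.+1)
}.

(** The free choice of starting point lets any deleted vertex be taken as [v 0]. *)
Lemma cyclic_walk_from (n : nat) (e : rel 'I_n) (x : 'I_n) :
  is_cycle_graph e n -> exists2 v, cyclic_walk e v & v 0 = x.
Proof.
move=> [f f_bij ef]; have n0 : (0 < n)%N := leq_ltn_trans (leq0n x) (ltn_ord x).
pose o k := Ordinal (ltn_pmod k n0).
have oS k : ordS (o k) = o k.+1.
  by apply/val_inj; rewrite /= -addn1 modnDml addn1.
have oD k : o (k %% n)%N = o k by apply/val_inj; rewrite /= modn_mod.
case: (f_bij) => g fK gK; exists (fun k => f (o (g x + k)%N)).
  split=> i j; last by rewrite ef !addnS !oS !(bij_eq f_bij).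
  by rewrite (bij_eq f_bij) -val_eqE /= eqn_modDl.
by rewrite addn0 -[RHS]gK; congr f; apply/val_inj; rewrite /= modn_small.
Qed.

Section CyclicWalk.

Variables (n : nat) (e : rel 'I_n) (v : nat -> 'I_n).
Hypothesis walk : cyclic_walk e v.

Lemma walkDn k : v (k + n)%N = v k.
Proof. by apply/eqP; rewrite (walk_eq walk) modnDr. Qed.

Lemma walk_neq i j : (i < j < i + n)%N -> v j != v i.
Proof.
case/andP=> ij jn; rewrite (walk_eq walk) -(subnKC (ltnW ij)).
rewrite -[X in _ != X %[mod _]]addn0 eqn_modDl mod0n modn_small ?subn_eq0 -?ltnNge //.
by rewrite ltn_subLR // ltnW.
Qed.

Lemma walk_ord_inj : injective (fun k : 'I_n => v k).
Proof.
move=> i j /eqP; rewrite (walk_eq walk) !modn_small // => /eqP; exact: val_inj.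
Qed.

Definition walk_index (x : 'I_n) : 'I_n := invF walk_ord_inj x.

Lemma walk_indexK x : v (walk_index x) = x.
Proof. exact: (f_invF walk_ord_inj). Qed.

Lemma walk_neighbor k x : e (v k.+1) x -> x = v k \/ x = v k.+2.
Proof.
rewrite -{1}(walk_indexK x) (walk_arc walk) !walk_indexK => /orP[/eqP|]; first by right.
rewrite (walk_eq walk) -(addn1 k) -(addn1 (walk_index x)) eqn_modDr -(walk_eq walk) walk_indexK => /eqP.
by left.
Qed.

Lemma walk_arcS k : e (v k) (v k.+1).
Proof. by rewrite (walk_arc walk) eqxx. Qed.

Lemma big_walk (S : Type) (idx : S) (op : Monoid.com_law idx) (F : 'I_n -> S) :
  \big[op/idx]_x F x = \big[op/idx]_(k < n) F (v k).
Proof. by rewrite (reindex_inj walk_ord_inj). Qed.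

(** Raising [m] by one moves the first factor to the end, where periodicity identifies it. *)
Lemma big_walk_shift (S : Type) (idx : S) (op : Monoid.com_law idx)
    (F : nat -> S) (m : nat) :
  (forall k, F (k + n)%N = F k) ->
  \big[op/idx]_(k < n) F (m + k)%N = \big[op/idx]_(k < n) F k.
Proof.
move=> Fn; elim: m => // m IHm; rewrite -IHm.
case: n Fn => [|n'] Fn; first by rewrite !big_ord0.
rewrite big_ord_recr big_ord_recl /= Monoid.mulmC addn0; congr (op _ _).
  by rewrite addSnnS Fn.
by apply: eq_bigr => i _; rewrite addSnnS.
Qed.

Lemma walk_index_walk k : (walk_index (v k) : nat) = (k %% n)%N.
Proof.
have /eqP := walk_indexK (v k).
by rewrite (walk_eq walk) [(walk_index _ %% n)%N]modn_small // => /eqP.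
Qed.

Lemma odd_walk_index k : ~~ odd n -> odd (walk_index (v k)) = odd k.
Proof.
move=> n_even; rewrite walk_index_walk {2}(divn_eq k n) oddD oddM.
by rewrite (negPf n_even) andbF.
Qed.

(** For even [n], reduction modulo [n] preserves parity, so the parity of the index is a proper
    2-colouring. *)
Lemma walk_even_arc : ~~ odd n ->
  forall x y, e x y -> odd (walk_index x) != odd (walk_index y).
Proof.
move=> n_even x y; rewrite -{1}(walk_indexK x) -{1}(walk_indexK y) (walk_arc walk).
case/orP => /eqP/(congr1 (fun z => odd (walk_index z))); rewrite !odd_walk_index //= => ->.
  by case: (odd _).
by case: (odd _).
Qed.

End CyclicWalk.

(** * Symmetric matrices supported on a cycle *)

Lemma prod_even_odd (S : comPzRingType) (F : nat -> S) h :
  \prod_(k < h.*2) F k = \prod_(k < h) F k.*2 * \prod_(k < h) F k.*2.+1.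
Proof.
elim: h => [|h IHh]; first by rewrite !big_ord0 mulr1.
by rewrite doubleS !big_ord_recr /= IHh; ring.
Qed.

Section WeightedCycle.

Variables (R : realType) (n : nat) (e : rel 'I_n) (v : nat -> 'I_n).
Variable A : 'M[R]_n.
Hypothesis n_ge3 : (3 <= n)%N.
Hypothesis walk : cyclic_walk e v.
Hypothesis symA : A^T = A.
Hypothesis suppA : forall i j, (A i j != 0) = e i j.

Local Notation a k := (A (v k) (v k.+1)).

Lemma mul_walkS (x : 'rV[R]_n) k :
  (x *m A) 0 (v k.+1) = a k * x 0 (v k) + a k.+1 * x 0 (v k.+2).
Proof.
(* Since [n] is at least 3, the two neighbours of [v k.+1] differ and give separate terms. *)
have vv : v k.+2 != v k by apply: (walk_neq walk); lia.
rewrite mxE (bigD1 (v k)) //= (bigD1 (v k.+2)) //= big1 => [|i /andP[ik ik2]].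
  by rewrite addr0 mulrC -[in X in _ + X]symA mxE; congr (_ + _); rewrite mulrC.
apply/eqP; rewrite mulf_eq0; apply/orP; right.
rewrite -[_ == _]negbK -symA mxE suppA; apply/negP => /(walk_neighbor walk) [] E.
  by rewrite E eqxx in ik.
by rewrite E eqxx in ik2.
Qed.

Lemma walk_weight_neq0 k : a k != 0.
Proof. by rewrite suppA (walk_arcS walk). Qed.

(** Each vanishing entry of [x *m A] links two coordinates two steps apart by nonzero weights, so a
    zero propagates. *)
Lemma walk_zero_fwd (x : 'rV[R]_n) m k :
  (forall i, (i < k)%N -> (x *m A) 0 (v (m + i.*2)%N.+1) = 0) ->
  x 0 (v m) = 0 -> x 0 (v (m + k.*2)%N) = 0.
Proof.
move=> xA xm; elim: k xA => [|k IHk] xA; first by rewrite addn0.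
have/eqP := xA k (ltnSn k); rewrite mul_walkS IHk => [|i ik]; last exact: xA (ltnW ik).
by rewrite mulr0 add0r mulf_eq0 (negPf (walk_weight_neq0 _)) doubleS !addnS => /eqP.
Qed.

Lemma walk_zero_bwd (x : 'rV[R]_n) m k :
  (forall i, (i < k)%N -> (x *m A) 0 (v (m + i.*2)%N.+1) = 0) ->
  x 0 (v (m + k.*2)%N) = 0 -> x 0 (v m) = 0.
Proof.
elim: k => [|k IHk] xA xmk; first by rewrite addn0 in xmk.
apply: IHk => [i ik|]; first exact: xA (ltnW ik).
have/eqP := xA k (ltnSn k); rewrite mul_walkS.
move: xmk; rewrite doubleS !addnS => ->.
by rewrite mulr0 addr0 mulf_eq0 (negPf (walk_weight_neq0 _)) => /eqP.
Qed.

(** The extended kernel vector vanishes at [v 0], which is also [v n]. Zeros spread forwards from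
    index 0 to the even indices and, [n] being odd, backwards from index [n] to the odd ones. *)
Lemma det_minor_odd : odd n -> \det (row' (v 0) (col' (v 0) A)) != 0.
Proof.
move=> n_odd; apply/det0P => -[x /eqP x0 xB]; apply: x0.
apply: (@extend0_eq0 _ _ (v 0)); set y := extend0 _ _.
have yA k : (0 < k < n)%N -> (y *m A) 0 (v k) = 0.
  by move=> kn; apply: extend0_ker => //; apply: (walk_neq walk); lia.
have y0 : y 0 (v 0) = 0 by exact: extend0_at.
apply/rowP => i; rewrite [RHS]mxE -(walk_indexK walk i).
case: (walk_index walk i) => k /= kn.
case: (boolP (odd k)) => k_odd.
  apply: (@walk_zero_bwd _ _ (n - k)./2) => [i' i'k|]; first by apply: yA; lia.
  by rewrite even_halfK ?oddB ?n_odd ?k_odd 1?ltnW // subnKC 1?ltnW // (walkDn walk 0).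
rewrite -[k](even_halfK k_odd) -[_.*2]add0n.
by apply: walk_zero_fwd => // i' i'k; apply: yA; lia.
Qed.

Lemma det_minor_even : ~~ odd n -> \det (row' (v 0) (col' (v 0) A)) = 0.
Proof.
move=> n_even.
apply: (@det_bipartite_odd _ _ _ (fun i => odd (walk_index walk (lift (v 0) i)))).
  by case: n n_ge3 n_even => //= n' _; rewrite negbK.
move=> i j ij; apply/eqP; rewrite !mxE -[_ == _]negbK suppA.
by apply: contraTN isT => /(walk_even_arc walk n_even); rewrite ij eqxx.
Qed.

(** Deleting [v 1] as well leaves a path on [n - 2] vertices. Zeros spread forwards from [v 1] to
    the odd indices and backwards from [v n] to the even ones. *)
Lemma cofactor_minor_even : ~~ odd n ->
  exists j, cofactor (row' (v 0) (col' (v 0) A)) j j != 0.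
Proof.
move=> n_even; have v10 : v 0 != v 1 by rewrite eq_sym; apply: (walk_neq walk); lia.
have [j vj _] := unlift_some v10; exists j.
rewrite mulf_eq0 signr_eq0 /=; apply/det0P => -[x /eqP x0 xB]; apply: x0.
apply: (@extend0_eq0 _ _ j); apply: (@extend0_eq0 _ _ (v 0)).
set y := extend0 _ x; set z := extend0 _ _.
have zA k : (1 < k < n)%N -> (z *m A) 0 (v k) = 0.
  move=> kn; have k0 : v 0 != v k by rewrite eq_sym; apply: (walk_neq walk); lia.
  have [i vi _] := unlift_some k0; rewrite vi mul_extend0; apply: extend0_ker => //.
  have : v k != v 1 by apply: (walk_neq walk); lia.
  by rewrite vi vj; apply: contra_neq => ->.
have z0 : z 0 (v 0) = 0 by exact: extend0_at.
have z1 : z 0 (v 1) = 0 by rewrite vj extend0_lift extend0_at.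
have zn : z 0 (v n) = 0 by rewrite (walkDn walk 0).
apply/rowP => i; rewrite [RHS]mxE -(walk_indexK walk i).
case: (walk_index walk i) => [[|k] kn] //=.
case: (boolP (odd k)) => k_odd.
  apply: (@walk_zero_bwd _ _ (n - k.+1)./2) => [i' i'k|]; first by apply: zA; lia.
  by rewrite even_halfK ?subnKC 1?ltnW // oddB 1?ltnW //= k_odd (negPf n_even).
rewrite -[k](even_halfK k_odd) -(add1n k./2.*2).
by apply: walk_zero_fwd => // i' i'k; apply: zA; lia.
Qed.

(** * Singularity of the whole cycle *)

(** The two-step recurrence is iterated [k] times, with denominators cleared. *)
Lemma walk_ker_double (x : 'rV[R]_n) m k : x *m A = 0 ->
  \prod_(i < k) a (m + i.*2)%N.+1 * x 0 (v (m + k.*2)%N) =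
  (-1) ^+ k * \prod_(i < k) a (m + i.*2)%N * x 0 (v m).
Proof.
move=> xA; elim: k => [|k IHk]; first by rewrite !big_ord0 addn0 expr0 !mul1r.
have := mul_walkS x (m + k.*2); rewrite xA mxE => /esym/eqP.
rewrite addrC addr_eq0 => /eqP step.
rewrite !big_ord_recr /= doubleS !addnS exprS -mulrA step.
by rewrite mulrN mulrCA IHk; ring.
Qed.

(** If a kernel vector is nonzero at [v m], one full turn equates the product of the weights at odd
    offsets from [m] with [(-1) ^+ n./2] times that at even offsets. The signed product of all
    weights is then a square, hence not negative. *)
Lemma det_cycle_neq0 : ~~ odd n ->
  (-1) ^+ n./2 * \prod_(k < n) a k < 0 -> \det A != 0.
Proof.
move=> n_even neg; apply/det0P => -[x /eqP x0 xA]; apply: x0.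
have hn : n./2.*2 = n by exact: even_halfK.
apply/rowP => i; rewrite mxE -(walk_indexK walk i).
move: (nat_of_ord _) => m; have := walk_ker_double m n./2 xA.
rewrite hn (walkDn walk) => /eqP; rewrite -subr_eq0 -mulrBl mulf_eq0.
case/orP => /eqP // /eqP; rewrite subr_eq0 => /eqP E.
have aD k : a (k + n)%N = a k by rewrite -addSn !(walkDn walk).
have := prod_even_odd (fun k => a (m + k)%N) n./2; rewrite hn => prodE.
move: neg; rewrite -(big_walk_shift _ m aD) prodE.
under [X in _ * (_ * X)]eq_bigr do rewrite addnS.
by rewrite E ltNge mulrA -expr2 sqr_ge0.
Qed.

Lemma det_cycle_eq0 : ~~ odd n -> (forall k, a k ^+ 2 = 1) ->
  (-1) ^+ n./2 * \prod_(k < n) a k = 1 -> \det A = 0.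
Proof.
move=> n_even a2 closed.
(* Solving the recurrence from value 1 at [v 0]: weights of square 1 are their own inverses, so
   ratios become products. *)
pose z k := (-1) ^+ k./2 * \prod_(t < k) a t.
pose x : 'rV[R]_n :=
  \row_i if odd (walk_index walk i) then 0 else z (walk_index walk i).
have x_odd k : odd k -> x 0 (v k) = 0.
  by move=> k_odd; rewrite mxE odd_walk_index // k_odd.
(* The case [k = n] is where [closed] enters: [v n] is [v 0], and [z n] equals [z 0], which is 1. *)
have x_even k : (k <= n)%N -> ~~ odd k -> x 0 (v k) = z k.
  move=> kn k_even; rewrite mxE odd_walk_index // (negPf k_even) walk_index_walk.
  move: kn; rewrite leq_eqVlt => /predU1P[->|kn]; last by rewrite modn_small.
  by rewrite modnn /z closed big_ord0 mulr1.
apply/eqP/det0P; exists x.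
  apply/eqP => /rowP/(_ (v 0)); rewrite x_even // mxE /z big_ord0 mulr1.
  by move/eqP; rewrite oner_eq0.
have ker k : (k < n)%N -> (x *m A) 0 (v k.+1) = 0.
  move=> kn; rewrite mul_walkS; case: (boolP (odd k)) => k_odd.
    by rewrite !x_odd ?mulr0 ?addr0 //= negbK.
  have k2n : (k.+2 <= n)%N by lia.
  rewrite (x_even k) 1?ltnW // (x_even k.+2) //= ?negbK //.
  rewrite /z !big_ord_recr /= exprS.
  have := a2 k.+1; set b := A _ _ => b2.
  set p := \prod_(i < k) _.
  rewrite [LHS](_ : _ = a k * ((-1) ^+ k./2 * p) * (1 - b ^+ 2)); last by ring.
  by rewrite b2 subrr mulr0.
apply/rowP => i; rewrite [RHS]mxE -(walk_indexK walk i).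
case: (walk_index walk i) => -[|k] /= kn; last by rewrite ker // ltnW.
by rewrite -(walkDn walk 0) add0n -[n in v n](prednK kn) ker // prednK.
Qed.

End WeightedCycle.

(** * Simple cycles in a cycle graph *)

Lemma next_next_neq (T : eqType) (s : seq T) (x : T) :
  uniq s -> (2 < size s)%N -> x \in s -> next s (next s x) != x.
Proof.
move=> s_uniq s_size xs; have [i s' sE] := rot_to xs.
rewrite -!(next_rot i s_uniq) sE.
have : uniq (x :: s') by rewrite -sE rot_uniq.
have : (2 < size (x :: s'))%N by rewrite -sE size_rot.
case: s' sE => [|y [|z s']] //= _ _ /and3P[].
rewrite !inE !negb_or => /and3P[xy xz _] _ _.
by rewrite eqxx [y == x]eq_sym (negPf xy) eqxx eq_sym.
Qed.

Section Cycles.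

Variables (n : nat) (e : rel 'I_n) (v : nat -> 'I_n).
Hypothesis walk : cyclic_walk e v.

Lemma walk_all (s : seq 'I_n) : (forall k, v k \in s) -> forall x, x \in s.
Proof. by move=> vs x; rewrite -(walk_indexK walk x). Qed.

(* Past its first step, a cycle that never backtracks has no choice: it follows
   the walk either forwards or backwards. *)
Lemma long_cycle_walk (s : seq 'I_n) : uniq s -> cycle e s -> (2 < size s)%N ->
  (forall x, x \in s) /\
  ((forall k, next s (v k) = v k.+1) \/ (forall k, next s (v k.+1) = v k)).
Proof.
move=> s_uniq s_cycle s_size.
have arc x : x \in s -> e x (next s x) by exact: next_cycle.
have nn x := @next_next_neq _ s x s_uniq s_size.
have n_gt0 : (0 < n)%N by case: s s_size {arc nn s_uniq s_cycle} => // y s _; exact: leq_ltn_trans (ltn_ord y).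
have shift j k : v (j + n * k)%N = v j.
  by apply/eqP; rewrite (walk_eq walk) addnC mulnC modnMDl.
have [x xs] : {x | x \in s}.
  by case: s s_size {arc nn s_uniq s_cycle} => // y s _; exists y; rewrite mem_head.
(* Writing the starting vertex as a successor names both of its neighbours, [v k0] and [v k0.+2]. *)
have xE : x = v (walk_index walk x + n.-1).+1.
  by rewrite -addnS prednK // (walkDn walk) walk_indexK.
move: (_ + _)%N xE => k0 xE; rewrite {x}xE in xs.
case: (walk_neighbor walk (arc _ xs)) => next_x.
  have down j i : v (j + i)%N.+1 \in s -> next s (v (j + i)%N.+1) = v (j + i)%N ->
      v j.+1 \in s /\ next s (v j.+1) = v j.
    elim: i => [|i IHi]; first by rewrite addn0.
    rewrite addnS => vi ni; have vi1 : v (j + i)%N.+1 \in s by rewrite -ni mem_next.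
    apply: IHi => //; move: (arc _ vi1) (nn _ vi); rewrite ni.
    by case/(walk_neighbor walk) => ->; rewrite ?eqxx.
  have {}down j : v j.+1 \in s /\ next s (v j.+1) = v j.
    (* The descent to [j] starts from [k0 + n * j], a translate of [k0] by full turns that is at
       least [j]. *)
    apply: (down j (k0 + n * j - j)%N); rewrite subnKC; try nia.
      by rewrite -addSn shift.
    by rewrite -addSn !shift.
  split; last by right => k; case: (down k).
  by apply: walk_all => k; case: (down k) => + <-; rewrite mem_next.
have up i : v (k0.+1 + i)%N \in s /\ next s (v (k0.+1 + i)%N) = v (k0.+1 + i)%N.+1.
  elim: i => [|i [vi ni]]; first by rewrite addn0.
  have vi1 : v (k0.+1 + i.+1)%N \in s by rewrite addnS -ni mem_next.
  split=> //; move: (arc _ vi1) (nn _ vi); rewrite !addnS ni.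
  by case/(walk_neighbor walk) => ->; rewrite ?eqxx.
have {}up j : v j \in s /\ next s (v j) = v j.+1.
  have := up (j + n * k0.+1 - k0.+1)%N; rewrite subnKC; last by nia.
  by rewrite -addSn !shift.
by split; [apply: walk_all => k; case: (up k) | left=> k; case: (up k)].
Qed.

(** Such a cycle visits every vertex, and symmetry of [F] makes its direction irrelevant. *)
Lemma long_cycle_prod (S : comPzRingType) (F : 'I_n -> 'I_n -> S) (s : seq 'I_n) :
  (forall x y, F x y = F y x) ->
  uniq s -> cycle e s -> (2 < size s)%N ->
  size s = n /\ \prod_(x <- s) F x (next s x) = \prod_(k < n) F (v k) (v k.+1).
Proof.
move=> F_sym s_uniq s_cycle s_size.
have [s_all next_s] := long_cycle_walk s_uniq s_cycle s_size.
have s_perm : perm_eq s (index_enum 'I_n).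
  by apply: uniq_perm => // [|x]; rewrite ?index_enum_uniq // s_all mem_index_enum.
split.
  by rewrite -(card_uniqP s_uniq) -[RHS]card_ord; apply: eq_card => x; rewrite s_all.
rewrite (perm_big _ s_perm) /= (big_walk walk).
case: next_s => next_s; first by apply: eq_bigr => k _; rewrite next_s.
have Fn k : F (v (k + n)%N) (next s (v (k + n)%N)) = F (v k) (next s (v k)).
  by rewrite (walkDn walk).
rewrite -(big_walk_shift _ 1%N Fn).
by apply: eq_bigr => k _; rewrite add1n next_s F_sym.
Qed.

End Cycles.

(** * Signs of composite cycles of length n *)

Section CompositeCycles.

Variables (n : nat) (P : 'M[int]_n) (v : nat -> 'I_n).
Hypothesis walk : cyclic_walk (pattern_arc P) v.
Hypothesis P_sign : sign_pattern P.
Hypothesis P_sym : symmetric_pattern P.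
Hypothesis P_diag : forall i, P i i = 0.
Hypothesis n_even : ~~ odd n.
Hypothesis n_ge3 : (3 <= n)%N.

Local Notation p k := (P (v k) (v k.+1)).

Lemma arc_sign_sqr i j : pattern_arc P i j -> P i j * P i j = 1.
Proof.
move=> ij; have := P_sign i j; rewrite !inE (negPf ij) orbF.
by case/orP => /eqP->.
Qed.

(** The zero diagonal excludes loops, an edge contributes minus a square, and a longer cycle is the
    whole graph, with sign factor -1 because [n.-1] is odd. *)
Lemma simple_cycle_cases (s : seq 'I_n) : simple_cycle P s ->
  size s = 2 /\ simple_sign P s = -1 \/
  size s = n /\ simple_sign P s = - \prod_(k < n) p k.
Proof.
case/and3P; case: (ltngtP 2 (size s)) => [s_size _ s_uniq s_cycle | | ].
- right; have [s_n s_prod] := long_cycle_prod walk P_sym s_uniq s_cycle s_size.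
  split=> //; rewrite /simple_sign s_prod s_n.
  by rewrite -signr_odd -subn1 oddB 1?ltnW 1?ltnW // (negPf n_even) mulN1r.
- case: s => [|x [|y s]] //= _ _ _; rewrite andbT.
  by rewrite /pattern_arc P_diag eqxx.
- case: s => [|x [|y [|z s]]] //= _ _; rewrite inE andbT => xy /and3P[arc_xy _ _].
  left; split=> //; rewrite /simple_sign /= !big_cons big_nil /= eqxx.
  rewrite [y == x]eq_sym (negPf xy) eqxx expr1 mulr1 [P y x]P_sym.
  by rewrite arc_sign_sqr.
Qed.

(** Either all components have length 2 and there are [n./2] of them, or one has length [n] and
    leaves no room for another. *)
Lemma composite_sign_cases (G : seq (seq 'I_n)) :
  composite_cycle P G -> composite_length G = n ->
  composite_sign P G = (-1) ^+ n./2 \/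
  composite_sign P G = - \prod_(k < n) p k.
Proof.
case/and3P=> _ /allP G_simple _ G_len.
case: (boolP (all (fun s => size s == 2) G)) => [/allP two | /allPn[s sG s2]].
  left; have sizeG : (size G).*2 = n.
    apply/esym; rewrite -[LHS]G_len -muln2 /composite_length big_seq (eq_bigr (fun=> 2%N)) => [|s sG].
      by rewrite -big_seq big_const_seq count_predT iter_addn_0 mulnC.
    exact/eqP/two.
  rewrite -[in RHS]sizeG half_double /composite_sign big_seq (eq_bigr (fun=> -1)) => [|s sG].
    by rewrite -big_seq big_const_seq count_predT -Monoid.iteropE.
  case: (simple_cycle_cases (G_simple s sG)) => -[s_size] //.
  by move/eqP: (two s sG); lia.
right; case: (simple_cycle_cases (G_simple s sG)) => -[s_size s_sign].
  by rewrite s_size in s2.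
have G_perm := perm_to_rem sG.
have : (\sum_(t <- rem s G) size t = 0)%N.
  apply: (@addnI n); apply/esym; rewrite addn0 -[LHS]G_len.
  by rewrite /composite_length (perm_big _ G_perm) big_cons s_size.
rewrite /composite_sign (perm_big _ G_perm) big_cons s_sign.
case: (rem s G) (@mem_rem _ s G) => [|t G'] sub; first by rewrite 2!big_nil /= mulr1.
have /and3P[t_size _ _] := G_simple t (sub t (mem_head _ _)).
by rewrite big_cons => /eqP; rewrite /= addn_eq0 eqn0Ngt t_size.
Qed.

Lemma full_cycle_composite : exists2 G, composite_cycle P G &
  composite_length G = n /\ composite_sign P G = - \prod_(k < n) p k.
Proof.
pose s := [seq v k | k <- iota 0 n].
have s_size : size s = n by rewrite size_map size_iota.
have s_cycle : simple_cycle P s.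
  apply/and3P; split; first by rewrite s_size; lia.
    rewrite map_inj_in_uniq ?iota_uniq // => i j; rewrite !mem_iota /= !add0n => iN jN /eqP.
    by rewrite (walk_eq walk) !modn_small // => /eqP.
  have v_path m k : path (pattern_arc P) (v m) [seq v i | i <- iota m.+1 k].
    by elim: k m => //= k IHk m; rewrite (walk_arcS walk) IHk.
  have iota0 : iota 0 n = 0%N :: iota 1 n.-1 by rewrite -{1}(ltn_predK n_ge3).
  (* Since [v 0] is [v n], the closed cycle is the path through [v 0], ..., [v n]. *)
  rewrite /s iota0 /= -(walkDn walk 0) -map_rcons.
  rewrite (_ : rcons _ _ = iota 1 n); first by rewrite (walkDn walk).
  by rewrite -[n in RHS](ltn_predK n_ge3) -(addn1 n.-1) iotaD cats1 add1n (ltn_predK n_ge3).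
exists [:: s]; first by rewrite /composite_cycle /= s_cycle.
rewrite /composite_length /composite_sign !big_seq1; split=> //.
case: (simple_cycle_cases s_cycle) => -[] // s2; lia.
Qed.

Lemma matching_composite : exists2 G, composite_cycle P G &
  composite_length G = n /\ composite_sign P G = (-1) ^+ n./2.
Proof.
(* One of the two perfect matchings, pairing each even index with the next. *)
pose G := [seq [:: v i.*2; v i.*2.+1] | i <- iota 0 n./2].
have hn : n./2.*2 = n by exact: even_halfK.
have v_neq i j : (i < n)%N -> (j < n)%N -> i != j -> v i != v j.
  by move=> iN jN; rewrite (walk_eq walk) !modn_small.
have G_simple i : (i < n./2)%N -> simple_cycle P [:: v i.*2; v i.*2.+1].
  move=> ih; rewrite /simple_cycle /= inE andbT v_neq; try lia.
  by rewrite /pattern_arc [P (v _.+1) _]P_sym andbT andbb; apply: (walk_arcS walk).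
exists G.
  apply/and3P; split; first by rewrite size_map size_iota; lia.
    by apply/allP => s /mapP[i]; rewrite mem_iota /= => ih ->; apply: G_simple.
  rewrite pairwise_map; apply: (@sub_in_pairwise _ (mem (iota 0 n./2)) ltn).
  - move=> i j; rewrite !mem_iota /= => ih jh ij.
    rewrite disjoint_has /= !inE orbF !negb_or.
    by rewrite !v_neq //; lia.
  - exact/allP.
  - by rewrite -sorted_pairwise ?iota_ltn_sorted //; apply: ltn_trans.
split.
  rewrite /composite_length big_map (eq_bigr (fun=> 2%N)) // big_const_seq.
  by rewrite count_predT size_iota iter_addn_0 mulnC muln2.
rewrite /composite_sign big_map big_seq (eq_bigr (fun=> -1)) => [|i].
  by rewrite -big_seq big_const_seq count_predT size_iota -Monoid.iteropE.
rewrite mem_iota => ih; case: (simple_cycle_cases (G_simple i ih)) => -[] //=; lia.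
Qed.

End CompositeCycles.

(** * P-vertices and the main equivalence *)

Section QSYM.

Variables (R : realType) (n : nat) (P : 'M[int]_n).
Hypothesis n_ge3 : (3 <= n)%N.
Hypothesis G_cycle : is_cycle_graph (pattern_arc P) n.

Lemma Q_SYM_arc (A : 'M[R]_n) : Q_SYM P A ->
  forall i j, (A i j != 0) = pattern_arc P i j.
Proof. by case=> _ PA i j; rewrite /pattern_arc -PA sgz_eq0. Qed.

(** The right-hand side is a boolean read as 0 or 1: the remaining path is nonsingular for odd [n],
    and 0 is a simple eigenvalue for even [n]. *)
Lemma alg_mult0_minor (A : 'M[R]_n) (j : 'I_n) : Q_SYM P A ->
  alg_mult0 (row' j (col' j A)) = ~~ odd n.
Proof.
move=> QA; have [v walk <-] := cyclic_walk_from j G_cycle.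
have [symA suppA] := (proj1 QA, Q_SYM_arc QA).
case: (boolP (odd n)) => n_odd /=.
  by apply/eqP; rewrite alg_mult0_eq0 (det_minor_odd n_ge3 walk symA suppA).
have [k cof] := cofactor_minor_even n_ge3 walk symA suppA n_odd.
apply: alg_mult0_eq1 cof; last exact: (det_minor_even n_ge3 walk suppA n_odd).
by apply/matrixP => a b; rewrite !mxE -[in LHS]symA mxE.
Qed.

Lemma P_vertex_iff (A : 'M[R]_n) (j : 'I_n) : Q_SYM P A ->
  P_vertex A j <-> ~~ odd n /\ \det A != 0.
Proof.
move=> QA; rewrite /P_vertex alg_mult0_minor // -alg_mult0_eq0.
by case: (odd n) => /=; split=> [|[//]]; lia.
Qed.

Lemma Q_SYM_prod (A : 'M[R]_n) (v : nat -> 'I_n) : Q_SYM P A ->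
  sgz (\prod_(k < n) A (v k) (v k.+1)) = \prod_(k < n) P (v k) (v k.+1).
Proof.
case=> _ PA; rewrite (big_morph (@sgz R) (@sgzM R) (sgz1 R)).
by apply: eq_bigr => k _; rewrite PA.
Qed.

End QSYM.

Theorem theorem3p1 (R : realType) (n : nat) (P : 'M[int]_n)
    (n_ge3 : (3 <= n)%N)
    (P_sign : sign_pattern P)
    (P_sym : symmetric_pattern P)
    (P_diag : forall i, P i i = 0)
    (G_cycle : is_cycle_graph (pattern_arc P) n) :
  requires_full_P_vertices R P <->
  ~~ odd n /\
  (forall G1 G2 : seq (seq 'I_n),
      composite_cycle P G1 -> composite_length G1 = n ->
      composite_cycle P G2 -> composite_length G2 = n ->
      composite_sign P G1 = composite_sign P G2).
Proof.
pose x0 : 'I_n := Ordinal (ltnW (ltnW n_ge3)).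
have [v walk _] := cyclic_walk_from x0 G_cycle.
have s2 : (-1) ^+ n./2 * (-1) ^+ n./2 = 1 :> int by rewrite -expr2 sqrr_sign.
split=> [full | [n_even same] A QA j].
- pose A : 'M[R]_n := map_mx intr P.
  have QA : Q_SYM P A.
    split=> [|i j]; first by apply/matrixP => i j; rewrite !mxE P_sym.
    rewrite mxE sgz_int; have := P_sign i j; rewrite !inE.
    by case/or3P => /eqP->.
  have [n_even detA] := (P_vertex_iff n_ge3 G_cycle x0 QA).1 (full A QA x0).
  have A2 i j : pattern_arc P i j -> A i j ^+ 2 = 1.
    by move=> /(arc_sign_sqr P_sign) ij; rewrite mxE -rmorphXn expr2 ij.
  split=> //; pose pi := \prod_(k < n) P (v k) (v k.+1).
  have pi2 : pi * pi = 1.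
    by rewrite -big_split big1 //= => k _; rewrite arc_sign_sqr // (walk_arcS walk).
  (* The number [(-1) ^+ n./2 * pi] has square 1 and is not 1, since otherwise the matrix [A] of
     signs would be singular; so it is -1. *)
  have piE : (-1) ^+ n./2 = - pi.
    have open_walk : (-1) ^+ n./2 * pi != 1.
      apply: contra detA => /eqP closed.
      rewrite (det_cycle_eq0 n_ge3 walk _ (Q_SYM_arc QA)) //; first exact: (proj1 QA).
        by move=> k; rewrite A2 // (walk_arcS walk).
      have /(congr1 (intr : int -> R)) := closed.
      rewrite rmorphM rmorph_sign rmorph_prod; apply: etrans; congr (_ * _).
      by apply: eq_bigr => k _; rewrite mxE.
    have : (((-1) ^+ n./2 * pi) ^+ 2 == 1) by rewrite exprMn !expr2 s2 pi2.
    rewrite sqrf_eq1 (negPf open_walk) /= => /eqP E.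
    by rewrite -[LHS]mulr1 -[X in _ * X]pi2 mulrA E mulN1r.
  have sign_eq G : composite_cycle P G -> composite_length G = n ->
      composite_sign P G = - pi.
    move=> PG lenG; rewrite -piE.
    by case: (composite_sign_cases walk P_sign P_sym P_diag n_even n_ge3 PG lenG) => ->.
  by move=> G1 G2 PG1 len1 PG2 len2; rewrite !sign_eq.
- apply/(P_vertex_iff n_ge3 G_cycle j QA); split=> //.
  have [G1 PG1 [len1 sign1]] := full_cycle_composite walk P_sign P_sym P_diag n_even n_ge3.
  have [G2 PG2 [len2 sign2]] := matching_composite walk P_sign P_sym P_diag n_even n_ge3.
  (* Equal signs of the full cycle and the matching make [(-1) ^+ n./2] times the sign of the weight
     product -1, for every matrix of the pattern. *)
  have := same G1 G2 PG1 len1 PG2 len2; rewrite sign1 sign2 => piE.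
  apply: (det_cycle_neq0 n_ge3 walk (proj1 QA) (Q_SYM_arc QA) n_even).
  rewrite -sgz_lt0 sgzM (Q_SYM_prod v QA) -[X in _ * X]opprK piE.
  by rewrite sgzX sgzN1 mulrN s2.
Qed.
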